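(* Let $p,r>0$ and let $K\times\{\varphi_i:i=1,2,3\}\in\mathcal{P}(\Omega';p,r)$ be a proper set of measurements in $\Omega'$ with constants $p$ and $r$. Suppose that for some $b>0$ $$|E_k^{ii}(x)|,\ |e_k^{ii}(x)|\le b,\qquad x\in\Omega',$$ for all $k\in K$ and $i=1,2,3$. Let $x\in\Omega'$ and let $\bar k=\bar k(x)\in K$ be a frequency such that $$|u^1_{\bar k}(x)|\ge p\quad\text{and}\quad |\nabla u_{\bar k}^2(x)|\,|\nabla u_{\bar k}^3(x)|\,|\sin\theta_{\nabla u_{\bar k}^2,\nabla u_{\bar k}^3}(x)|\ge r .$$ Then there exists $C>0$ depending only on $\lambda$, $\beta_1$ and $b$ such that $$\frac{\mathrm{tr}(e_{\bar k})\,\mathrm{tr}(E_{\bar k})-\mathrm{tr}(e_{\bar k}E_{\bar k})}{\mathrm{tr}(e_{\bar k})^2}(x)\ \ge\ C\,p^2r^4,$$ and $a/q$ is given in terms of the data by $$\left|\nabla\bigl(e_{\bar k}/\mathrm{tr}(e_{\bar k})\bigr)\right|_2^2\,\frac{a}{q}=2\,\frac{\mathrm{tr}(e_{\bar k})\,\mathrm{tr}(E_{\bar k})-\mathrm{tr}(e_{\bar k}E_{\bar k})}{\mathrm{tr}(e_{\bar k})^2}\quad\text{at }x.$$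
   Context: Setting. $d\in\{2,3\}$, $\alpha\in(0,1)$, $\Omega'\subseteq\Omega\subseteq\mathbb{R}^d$ are bounded domains of class $\mathcal{C}^{1,\alpha}$. $a\in\mathcal{C}^{0,\alpha}(\overline\Omega)$ is a real scalar function with $\lambda\le a\le\Lambda$ for some $\lambda,\Lambda>0$; $q\in L^\infty(\Omega)$ is real-valued with $\beta_1\le q\le\beta_2$ a.e. in $\Omega$ for some $\beta_1,\beta_2>0$ (a representative of $q$ satisfying these bounds at every point is fixed, so that pointwise values make sense). $K_{ad}=[K_{\min},K_{\max}]$ with $0<K_{\min}<K_{\max}$. $\Sigma$ is the set of Dirichlet eigenvalues, i.e. of those $k$ for which $-\mathrm{div}(a\nabla u)-kqu=0$ in $\Omega$, $u=0$ on $\partial\Omega$ has a nontrivial weak solution in $H^1_0(\Omega;\mathbb{C})$. For $k\notin\Sigma$ and a real boundary datum $\varphi_i$ which is the trace on $\partial\Omega$ of a function in $\mathcal{C}^{1,\alpha}(\overline\Omega)$, $u_k^i$ denotes the unique weak solution of $$-\mathrm{div}(a\nabla u_k^i)-k\,q\,u_k^i=0\ \text{ in }\Omega,\qquad u_k^i=\varphi_i\ \text{ on }\partial\Omega,$$ which belongs to $\mathcal{C}^1(\overline\Omega)$. A set of measurements is a product $K\times\{\varphi_i\}$ with $K\subseteq K_{ad}\setminus\Sigma$ finite and finitely many such boundary data. For $p,r>0$, $\mathcal{P}(\Omega';p,r)$ is the collection of sets of measurements $K\times\{\varphi_i:i=1,2,3\}$ that are proper in $\Omega'$ with constants $p$ and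 $r$, i.e. such that for every $x\in\Omega'$ there exists $\bar k=\bar k(x)\in K$ with $|u_{\bar k}^1(x)|\ge p$ and $|\nabla u_{\bar k}^2(x)|\,|\nabla u_{\bar k}^3(x)|\,|\sin\theta_{\nabla u_{\bar k}^2,\nabla u_{\bar k}^3}(x)|\ge r$. Here $\theta_{v,w}=\arccos\frac{v\cdot w}{|v||w|}$ is the angle between nonzero vectors $v,w$. Internal energies: $e_k^{ij}=q\,u_k^i\,u_k^j$, $E_k^{ij}=a\,\nabla u_k^i\cdot\nabla u_k^j$ for $i,j\in\{1,2,3\}$, with the matrix-valued functions $e_k=(e_k^{ij})_{ij}$, $E_k=(E_k^{ij})_{ij}$. For a matrix-valued function $M$ of size $N$, $\mathrm{tr}(M)=\sum_{i=1}^N M_{ii}$ and $|\nabla M|_2^2=\sum_{i,j=1}^N|\nabla M_{ij}|^2$. Note that $e_k/\mathrm{tr}(e_k)$ has entries $u_k^iu_k^j/\sum_l (u_k^l)^2$ wherever $\mathrm{tr}(e_k)\neq0$. *)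

(* Defs.v *)
(* MathComp / MathComp-Analysis; R^d is 'rV[R]_d for an arbitrary R : realType. *)
From HB Require Import structures.
From mathcomp Require Import all_boot all_order all_algebra.
From mathcomp Require Import all_classical all_reals all_analysis.
From mathcomp Require Import complex.

Set Implicit Arguments.
Unset Strict Implicit.
Unset Printing Implicit Defensive.

Import Order.TTheory GRing.Theory Num.Theory.
Import numFieldNormedType.Exports.

Local Open Scope classical_set_scope.
Local Open Scope ring_scope.
Local Open Scope complex_scope.

(* The norm carried by 'rV[R]_d in the library is the maximum norm: it gives the
   right topology and derivatives, but lengths, angles and Hölder quotients
   below are Euclidean. *)
Section Euclidean.
Context {R : realType} {d : nat}.
Implicit Types v w : 'rV[R]_d.

Definition dot v w : R := \sum_i v ord0 i * w ord0 i.

Definition enorm v : R := Num.sqrt (dot v v).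

Definition eball (x : 'rV[R]_d) (rho : R) : set 'rV[R]_d :=
  [set y | enorm (y - x) < rho].

Definition angle v w : R := acos (dot v w / (enorm v * enorm w)).

Definition partial (i : 'I_d) (f : 'rV[R]_d -> R) (x : 'rV[R]_d) : R :=
  'D_(delta_mx ord0 i) f x.

Definition grad (f : 'rV[R]_d -> R) (x : 'rV[R]_d) : 'rV[R]_d :=
  \row_i partial i f x.

Definition bdry (A : set 'rV[R]_d) : set 'rV[R]_d := closure A `\` A°.

End Euclidean.

Section ClassicalSpaces.
Context {R : realType} {d : nat}.
Local Notation E := 'rV[R]_d.

(* uniform alpha-Hölder continuity on S: C^{0,alpha}(S) for bounded S *)
Definition holder_on (alpha : R) (S : set E) (f : E -> R) : Prop :=
  exists M : R, forall x y, S x -> S y ->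
    `|f x - f y| <= M * enorm (x - y) `^ alpha.

(* f belongs to C^1 of the closure of the open set A: only the values of f on
   closure A matter, and the g below is the continuous extension of the i-th
   partial derivative *)
Definition C1_closure (A : set E) (f : E -> R) : Prop :=
  [/\ {within closure A, continuous f},
      (forall x, A x -> differentiable f x) &
      forall i : 'I_d, exists2 g : E -> R,
        {within closure A, continuous g} & (forall x, A x -> g x = partial i f x)].

(* Hölder continuity of the derivatives on A extends to closure A. *)
Definition C1a_closure (alpha : R) (A : set E) (f : E -> R) : Prop :=
  C1_closure A f /\ forall i : 'I_d, holder_on alpha A (partial i f).

(* C^{1,alpha}(U), U open: locally Hölder derivatives, no condition at the
   boundary of U *)
Definition C1a_local (alpha : R) (U : set E) (f : E -> R) : Prop :=
  (forall x, U x -> differentiable f x) /\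
  forall (i : 'I_d) (S : set E), compact S -> S `<=` U ->
    holder_on alpha S (partial i f).

Definition C1a_map (alpha : R) (U : set E) (psi : E -> E) : Prop :=
  forall i : 'I_d, C1a_local alpha U (fun x => psi x ord0 i).

(* Bounded domain of class C^{1,alpha}, as in Gilbarg-Trudinger, Section 6.2:
   near each boundary point a C^{1,alpha} diffeomorphism psi of a ball onto an
   open set maps the domain into the half-space {y_d > 0} and its boundary into
   the hyperplane {y_d = 0}; [i.+1 = d] selects the last coordinate. *)
Definition C1a_domain (alpha : R) (A : set E) : Prop :=
  [/\ open A, connected A, A !=set0, bounded_set A &
   forall x0, bdry A x0 ->
     exists (rho : R) (psi psiV : E -> E), let B := eball x0 rho in
       [/\ 0 < rho,
           (forall x, B x -> psiV (psi x) = x),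
           (forall x (i : 'I_d), i.+1 = d :> nat -> (B `&` A) x ->
              0 < psi x ord0 i),
           (forall x (i : 'I_d), i.+1 = d :> nat -> (B `&` bdry A) x ->
              psi x ord0 i = 0) &
           [/\ open (psi @` B), C1a_map alpha B psi &
               C1a_map alpha (psi @` B) psiV]]].

(* C_c^oo(A) *)
Definition test_fun (A : set E) (v : E -> R) : Prop :=
  (forall (s : seq 'I_d) x, differentiable (foldr partial v s) x) /\
  let supp := closure [set x | v x != 0] in compact supp /\ supp `<=` A.

End ClassicalSpaces.

(* Lebesgue measure on 'rV[R]_d, as the Caratheodory restriction of the Lebesgue
   outer measure. [mu_ext] takes an infimum over countable covers by measurable
   sets; here all sets are measurable and each one is charged the volume of the
   smallest closed box containing it, so that this is the infimum over covers by
   boxes. The case of the empty set only matters when d = 0. *)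
Section Lebesgue.
Variables (R : realType) (d : nat).
Local Open Scope ereal_scope.

Definition discrete_rV := 'rV[R]_d.

HB.instance Definition _ := Pointed.on discrete_rV.
HB.instance Definition _ := @isMeasurable.Build default_measure_display
  discrete_rV discrete_measurable discrete_measurable0
  discrete_measurableC discrete_measurableU.

Definition box_volume (A : set discrete_rV) : \bar R :=
  if `[< A = set0 >] then 0 else
  ereal_inf [set (\prod_i (ab.2 ord0 i - ab.1 ord0 i)%R)%:E |
    ab in [set ab : 'rV[R]_d * 'rV[R]_d |
      (forall i, ab.1 ord0 i <= ab.2 ord0 i)%R /\
      forall x : 'rV[R]_d, A x ->
        forall i, (ab.1 ord0 i <= x ord0 i <= ab.2 ord0 i)%R]].

Lemma box_volume0 : box_volume set0 = 0.
Proof. by rewrite /box_volume; case: asboolP. Qed.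

Lemma box_volume_ge0 A : 0 <= box_volume A.
Proof.
rewrite /box_volume; case: asboolP => // _.
apply: le_ereal_inf_tmp => _ [ab [leab _] <-].
by rewrite lee_fin; apply: prodr_ge0 => i _; rewrite subr_ge0.
Qed.

Definition lebesgue_outer : set 'rV[R]_d -> \bar R := mu_ext box_volume.

HB.instance Definition _ := isOuterMeasure.Build R 'rV[R]_d lebesgue_outer
  (mu_ext0 box_volume0 box_volume_ge0) (mu_ext_ge0 box_volume_ge0)
  (le_mu_ext box_volume) (mu_ext_sigma_subadditive box_volume_ge0).

Let mu : {outer_measure set 'rV[R]_d -> \bar R} := lebesgue_outer.

Definition leb_rV := caratheodory_type mu.
HB.instance Definition _ := Measurable.on leb_rV.

Definition leb : {measure set leb_rV -> \bar R} :=
  (mu : set (caratheodory_type mu) -> \bar R).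

End Lebesgue.

Section Sobolev.
Context {R : realType} {d : nat}.
Local Notation E := 'rV[R]_d.
Implicit Types (A : set E) (f : E -> R) (Df : E -> E).

Definition int_on A f : R := (\int[@leb R d]_(x in (A : set (leb_rV R d))) f x)%R.

Definition L2 A f : Prop :=
  measurable_fun (A : set (leb_rV R d)) (f : leb_rV R d -> R) /\
  (\int[@leb R d]_(x in (A : set (leb_rV R d))) ((f x) ^+ 2)%:E < +oo)%E.

(* Df is the weak gradient of f and both are square integrable. *)
Definition H1 A f Df : Prop :=
  [/\ L2 A f, (forall i : 'I_d, L2 A (fun x => Df x ord0 i)) &
   forall (i : 'I_d) v, test_fun A v ->
     int_on A (fun x => f x * partial i v x) =
     - int_on A (fun x => Df x ord0 i * v x)].

(* closure of C_c^oo(A) in H^1(A) *)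
Definition H10 A f Df : Prop :=
  H1 A f Df /\
  exists2 v : nat -> E -> R, (forall n, test_fun A (v n)) &
    (fun n => int_on A (fun x =>
       (v n x - f x) ^+ 2 + dot (grad (v n) x - Df x) (grad (v n) x - Df x)))
    @ \oo --> (0 : R).

End Sobolev.

Section ComplexSobolev.
Context {R : realType} {d : nat}.
Local Notation E := 'rV[R]_d.
Local Notation C := R[i].
Implicit Types (A : set E) (u v : E -> C) (Du Dv : E -> 'rV[C]_d).

Definition int_onC A u : C :=
  int_on A (fun x => complex.Re (u x)) +i* int_on A (fun x => complex.Im (u x)).

Definition H1C A u Du : Prop :=
  H1 A (fun x => complex.Re (u x)) (fun x => map_mx (@complex.Re R) (Du x)) /\
  H1 A (fun x => complex.Im (u x)) (fun x => map_mx (@complex.Im R) (Du x)).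

Definition H10C A u Du : Prop :=
  H10 A (fun x => complex.Re (u x)) (fun x => map_mx (@complex.Re R) (Du x)) /\
  H10 A (fun x => complex.Im (u x)) (fun x => map_mx (@complex.Im R) (Du x)).

(* weak form of - div (a grad u) - k q u = 0 in A *)
Definition weak_eq A (a q : E -> R) (k : C) u Du : Prop :=
  forall v Dv, H10C A v Dv ->
    int_onC A (fun x =>
      (a x)%:C * (\sum_i Du x ord0 i * (Dv x ord0 i)^*)
      - k * (q x)%:C * u x * (v x)^*) = 0.

Definition dirichlet_eigenvalues A (a q : E -> R) : set C :=
  [set k | exists u Du, [/\ H10C A u Du, weak_eq A a q k u Du &
     ~ {ae @leb R d, forall x, A x -> u x = 0}]].

(* The trace of u on the boundary is phi: u - Phi lies in H^1_0(A) for an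
   extension Phi of phi in C^1 of the closure of A. *)
Definition has_trace A u Du (phi : E -> R) : Prop :=
  exists Phi : E -> R,
    [/\ C1_closure A Phi, (forall x, bdry A x -> Phi x = phi x) &
        H10C A (fun x => u x - (Phi x)%:C)
               (fun x => Du x - map_mx (real_complex R) (grad Phi x))].

Definition weak_solution A (a q : E -> R) (k : C) (phi : E -> R) u : Prop :=
  exists Du, [/\ H1C A u Du, weak_eq A a q k u Du & has_trace A u Du phi].

End ComplexSobolev.

(* The three boundary data and the corresponding solutions are indexed by 'I_3,
   which starts at 0; these are the mathematical indices 1, 2, 3. *)
Definition idx1 : 'I_3 := @Ordinal 3 0 isT.
Definition idx2 : 'I_3 := @Ordinal 3 1 isT.
Definition idx3 : 'I_3 := @Ordinal 3 2 isT.

Section Measurements.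
Context {R : realType} {d : nat}.
Local Notation E := 'rV[R]_d.

(* K x {phi_1, phi_2, phi_3} is a set of measurements *)
Definition measurements (alpha : R) (Omega : set E) (a q : E -> R)
    (Kmin Kmax : R) (K : set R) (phi : 'I_3 -> E -> R) : Prop :=
  [/\ finite_set K,
      (forall k, K k -> Kmin <= k <= Kmax /\
                        ~ dirichlet_eigenvalues Omega a q k%:C) &
      forall i, exists2 Phi, C1a_closure alpha Omega Phi &
        forall x, bdry Omega x -> Phi x = phi i x].

(* u k i is the solution u_k^i, or rather its representative in C^1 of the
   closure of Omega. *)
Definition solutions (Omega : set E) (a q : E -> R) (K : set R)
    (phi : 'I_3 -> E -> R) (u : R -> 'I_3 -> E -> R) : Prop :=
  forall k i, K k ->
    C1_closure Omega (u k i) /\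
    weak_solution Omega a q k%:C (phi i) (fun x => (u k i x)%:C).

Definition proper_at (p r : R) (u : 'I_3 -> E -> R) (x : E) : Prop :=
  p <= `|u idx1 x| /\
  r <= enorm (grad (u idx2) x) * enorm (grad (u idx3) x) *
       `|sin (angle (grad (u idx2) x) (grad (u idx3) x))|.

(* P(Omega'; p, r), u being the family of solutions associated with
   K x {phi_1, phi_2, phi_3} *)
Definition proper_measurements (alpha : R) (Omega Omega' : set E)
    (a q : E -> R) (Kmin Kmax p r : R) (K : set R) (phi : 'I_3 -> E -> R)
    (u : R -> 'I_3 -> E -> R) : Prop :=
  [/\ measurements alpha Omega a q Kmin Kmax K phi,
      solutions Omega a q K phi u &
      forall x, Omega' x -> exists2 k, K k & proper_at p r (u k) x].

End Measurements.

Section Energies.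
Context {R : realType} {d : nat}.
Local Notation E := 'rV[R]_d.

Definition e_mx (q : E -> R) (u : 'I_3 -> E -> R) (x : E) : 'M[R]_3 :=
  \matrix_(i, j) (q x * u i x * u j x).

Definition E_mx (a : E -> R) (u : 'I_3 -> E -> R) (x : E) : 'M[R]_3 :=
  \matrix_(i, j) (a x * dot (grad (u i) x) (grad (u j) x)).

Definition grad_mx_norm2 N (M : E -> 'M[R]_N) (x : E) : R :=
  \sum_i \sum_j enorm (grad (fun y => M y i j) x) ^+ 2.

End Energies.

(* Main.v *)
Require Import Defs.
From mathcomp Require Import all_boot all_order all_algebra.
From mathcomp Require Import all_classical all_reals all_analysis.
From mathcomp Require Import ring lra.

Import Order.TTheory GRing.Theory Num.Theory.
Import numFieldNormedType.Exports.

Local Open Scope classical_set_scope.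
Local Open Scope ring_scope.

(** The claim is algebraic in the values and first derivatives of the solutions
    at x. Write u for the vector of the three solutions at x,
    g_i for their gradients, s = |u|^2, and

      P = s (sum_i |g_i|^2) - |sum_i u_i g_i|^2.

    Since e is q times the matrix u u^T and E is a times the Gram matrix of the
    g_i, the right-hand side Q of the reconstruction formula equals
    (a / q) (P / s^2) ([energy_defect], [trace_e]). On the other side q cancels
    in e / tr e, which is the orthogonal projector u u^T / |u|^2 onto the line
    of u. The squared norm of its gradient is 2 P / s^2, because P / s^2 is the
    squared speed of the unit vector u / |u| ([proj_energy],
    [grad_norm2_normalized_e]). This gives the formula for a / q.

    For the lower bound, P is the sum of the |u_i g_j - u_j g_i|^2 over i < j.
    The identity

      2 u_1 (g_2 /\ g_3) = (u_1 g_2 - u_2 g_1) /\ g_3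
        - (u_1 g_3 - u_3 g_1) /\ g_2 - (u_2 g_3 - u_3 g_2) /\ g_1

    shows that P can be small only if the area |u_1| |g_2 /\ g_3| is, and
    quantitatively gives 2 u_1^2 |g_2 /\ g_3|^2 <= P G with G = sum_i |g_i|^2
    ([gram_defect_area]). The area |g_2 /\ g_3| is |g_2| |g_3| |sin theta|
    ([parallelogram_area]), so it is at least r. The energy bounds give
    a G <= 3 b and q s <= 3 b, whence Q is at least a multiple of p^2 r^2;
    finally r^2 <= |g_2|^2 |g_3|^2 <= (b / lambda)^2 trades r^2 for a multiple
    of r^4. *)

(** * Lengths, angles and areas *)

Lemma dotC (R : realType) (d : nat) (v w : 'rV[R]_d) : dot v w = dot w v.
Proof. by apply: eq_bigr => i _; rewrite mulrC. Qed.

Lemma dot_ge0 (R : realType) (d : nat) (v : 'rV[R]_d) : 0 <= dot v v.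
Proof. by apply: sumr_ge0 => i _; rewrite -expr2 sqr_ge0. Qed.

Lemma enorm_sqr (R : realType) (d : nat) (v : 'rV[R]_d) :
  enorm v ^+ 2 = dot v v.
Proof. by rewrite sqr_sqrtr// dot_ge0. Qed.

Lemma lagrange_identity (R : realType) (d : nat) (v w : 'rV[R]_d) :
  \sum_m \sum_n (v ord0 m * w ord0 n - v ord0 n * w ord0 m) ^+ 2 =
  2 * (dot v v * dot w w - dot v w ^+ 2).
Proof.
under eq_bigr => m _.
  under eq_bigr => n _.
    rewrite (_ : _ ^+ 2 = (v ord0 m * v ord0 m) * (w ord0 n * w ord0 n)
      + (w ord0 m * w ord0 m) * (v ord0 n * v ord0 n)
      - 2 * (v ord0 m * w ord0 m) * (v ord0 n * w ord0 n)); last by ring.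
  over.
  rewrite sumrB big_split -!mulr_sumr/=.
over.
rewrite sumrB big_split -!mulr_suml -mulr_sumr/= -!/(dot _ _).
by ring.
Qed.

Lemma cauchy_schwarz (R : realType) (d : nat) (v w : 'rV[R]_d) :
  dot v w ^+ 2 <= dot v v * dot w w.
Proof.
have : 0 <= 2 * (dot v v * dot w w - dot v w ^+ 2).
  rewrite -lagrange_identity.
  by apply: sumr_ge0 => m _; apply: sumr_ge0 => n _; exact: sqr_ge0.
by lra.
Qed.

(** A degenerate parallelogram, where the angle is meaningless, is covered too:
    if one of the vectors vanishes both sides do, by Cauchy-Schwarz. *)
Lemma parallelogram_area (R : realType) (d : nat) (v w : 'rV[R]_d) :
  (enorm v * enorm w * `|sin (angle v w)|) ^+ 2 =
  dot v v * dot w w - dot v w ^+ 2.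
Proof.
have cs := cauchy_schwarz R d v w.
rewrite /angle; set nn := enorm v * enorm w.
have nn2 : nn ^+ 2 = dot v v * dot w w by rewrite exprMn !enorm_sqr.
have [nn0|nn_neq0] := eqVneq nn 0.
  move: cs; rewrite -nn2 nn0 mul0r expr0n/= sub0r => cs.
  by apply/esym/eqP; rewrite oppr_eq0 eq_le cs sqr_ge0.
have nn_sq_gt0 : 0 < nn ^+ 2 by rewrite exprn_even_gt0.
have c2_le1 : (dot v w / nn) ^+ 2 <= 1.
  by rewrite expr_div_n ler_pdivrMr// mul1r nn2.
have c_itv : -1 <= dot v w / nn <= 1.
  by rewrite -ler_norml -(@expr_le1 _ 2)// real_normK ?num_real.
rewrite sin_acos// exprMn real_normK ?num_real// sqr_sqrtr ?subr_ge0//.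
by rewrite mulrBr mulr1 expr_div_n -nn2 [X in _ - X]mulrC divfK// gt_eqF.
Qed.

(** * The Gram defect *)

(** The trace of (|u|^2 I - u u^T) times the Gram matrix of g; by the Lagrange
    identity it is the sum of the |u_i g_j - u_j g_i|^2 over i < j. *)
Definition gram_defect {R : realType} {d N : nat}
    (u : 'I_N -> R) (g : 'I_N -> 'rV[R]_d) : R :=
  (\sum_i u i ^+ 2) * (\sum_i dot (g i) (g i)) -
  \sum_i \sum_j u i * u j * dot (g i) (g j).

Lemma gram_defect_coord (R : realType) (d N : nat)
    (u : 'I_N -> R) (g : 'I_N -> 'rV[R]_d) :
  gram_defect u g = \sum_m ((\sum_i u i ^+ 2) * (\sum_i g i ord0 m ^+ 2) -
                            (\sum_i u i * g i ord0 m) ^+ 2).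
Proof.
rewrite /gram_defect /dot sumrB -mulr_sumr; congr (_ * _ - _).
  by rewrite exchange_big.
under [RHS]eq_bigr do rewrite expr2 big_distrlr.
rewrite [RHS]exchange_big; apply: eq_bigr => i _.
rewrite [RHS]exchange_big; apply: eq_bigr => j _.
by rewrite mulr_sumr; apply: eq_bigr => m _; rewrite mulrACA.
Qed.

(** For scalars x, L x is the squared length of the cross product of u and x.
    When a and b are two coordinates of the gradients, this is the bound of
    u_1 (g_2 /\ g_3) by P and G, one component of the wedge product at a
    time. *)
Lemma cross_defect (R : realType) (u1 u2 u3 a1 a2 a3 b1 b2 b3 : R)
    (L := fun x1 x2 x3 => (u1 ^+ 2 + (u2 ^+ 2 + u3 ^+ 2)) *
      (x1 ^+ 2 + (x2 ^+ 2 + x3 ^+ 2)) - (u1 * x1 + (u2 * x2 + u3 * x3)) ^+ 2)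
    (G := fun x1 x2 x3 : R => x1 ^+ 2 + (x2 ^+ 2 + x3 ^+ 2)) :
  (2 * u1) ^+ 2 * (a2 * b3 - b2 * a3) ^+ 2 <=
  2 * (L a1 a2 a3 * G b1 b2 b3) + 2 * (G a1 a2 a3 * L b1 b2 b3).
Proof.
(* Cauchy-Schwarz between the cross product of u and x, and y with a sign. *)
have cs (x1 x2 x3 y1 y2 y3 : R) :
    ((u1 * x2 - u2 * x1) * y3 - (u1 * x3 - u3 * x1) * y2
     - (u2 * x3 - u3 * x2) * y1) ^+ 2 <= L x1 x2 x3 * G y1 y2 y3.
  set v3 := u1 * x2 - _; set v2 := u1 * x3 - _; set v1 := u2 * x3 - _.
  rewrite -subr_ge0 (_ : _ - _ = (v3 * y2 + v2 * y3) ^+ 2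
    + (v3 * y1 + v1 * y3) ^+ 2 + (v2 * y1 - v1 * y2) ^+ 2).
    by rewrite !addr_ge0// sqr_ge0.
  by rewrite /L /G /v1 /v2 /v3; ring.
have := cs b1 b2 b3 a1 a2 a3; have := cs a1 a2 a3 b1 b2 b3.
set X := (_ - _ - _); set Y := (_ - _ - _) => XL YL.
(* The terms containing u2 and u3 cancel when X and Y are subtracted. *)
have XY : (2 * u1) * (a2 * b3 - b2 * a3) = X - Y by rewrite /X /Y; ring.
have : 0 <= (X + Y) ^+ 2 by exact: sqr_ge0.
rewrite -exprMn XY [G a1 a2 a3 * _]mulrC.
have -> : (X - Y) ^+ 2 = 2 * X ^+ 2 + 2 * Y ^+ 2 - (X + Y) ^+ 2 by ring.
by lra.
Qed.

(** Summing [cross_defect] over all pairs of coordinates reassembles both sides: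
    the squared components of g_2 /\ g_3 add up to twice its squared area. *)
Lemma gram_defect_area (R : realType) (d : nat)
    (u : 'I_3 -> R) (g : 'I_3 -> 'rV[R]_d) :
  2 * u idx1 ^+ 2 * (dot (g idx2) (g idx2) * dot (g idx3) (g idx3)
                     - dot (g idx2) (g idx3) ^+ 2) <=
  gram_defect u g * \sum_i dot (g i) (g i).
Proof.
pose G n := \sum_i g i ord0 n ^+ 2.
pose L m := (\sum_i u i ^+ 2) * G m - (\sum_i u i * g i ord0 m) ^+ 2.
have sumG : \sum_n G n = \sum_i dot (g i) (g i) by rewrite exchange_big.
have sumL : \sum_m L m = gram_defect u g by rewrite gram_defect_coord.
have pointwise m n : (2 * u idx1) ^+ 2 *
    (g idx2 ord0 m * g idx3 ord0 n - g idx2 ord0 n * g idx3 ord0 m) ^+ 2 <=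
    2 * (L m * G n) + 2 * (G m * L n).
  rewrite /L /G !big_ord_recl !big_ord0 !addr0.
  have -> : lift ord0 (ord0 : 'I_2) = idx2 by exact: val_inj.
  have -> : lift ord0 (lift ord0 (ord0 : 'I_1)) = idx3 by exact: val_inj.
  have -> : (ord0 : 'I_3) = idx1 by exact: val_inj.
  exact: cross_defect.
have : \sum_m \sum_n (2 * u idx1) ^+ 2 *
    (g idx2 ord0 m * g idx3 ord0 n - g idx2 ord0 n * g idx3 ord0 m) ^+ 2 <=
    \sum_m \sum_n (2 * (L m * G n) + 2 * (G m * L n)).
  by apply: ler_sum => m _; apply: ler_sum => n _.
under eq_bigr do rewrite -mulr_sumr.
rewrite -mulr_sumr lagrange_identity.
under [leRHS]eq_bigr do rewrite big_split -!mulr_sumr/=.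
rewrite big_split -!mulr_sumr -!mulr_suml/= sumG sumL.
by lra.
Qed.

(** If u moves with velocity g, the summand is the square of the velocity of the
    (i, j) entry of u u^T / |u|^2. Each square expands into products of a factor
    in i and a factor in j, so that the double sum is a polynomial in s, t and
    the sum of the g_i^2. *)
Lemma proj_energy (R : realType) (N : nat) (u g : 'I_N -> R)
    (s := \sum_i u i ^+ 2) (t := \sum_i u i * g i) :
  s != 0 ->
  \sum_i \sum_j ((u i * g j + u j * g i) / s - u i * u j * (2 * t) / s ^+ 2) ^+ 2
  = 2 * (s * (\sum_i g i ^+ 2) - t ^+ 2) / s ^+ 2.
Proof.
move=> s0.
under eq_bigr => i _.
  under eq_bigr => j _.
    rewrite (_ : _ ^+ 2 = s ^- 2 * (u i ^+ 2 * g j ^+ 2)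
      + s ^- 2 * (g i ^+ 2 * u j ^+ 2)
      + 2 * s ^- 2 * (u i * g i * (u j * g j))
      + 4 * t ^+ 2 * s ^- 4 * (u i ^+ 2 * u j ^+ 2)
      - 4 * t * s ^- 3 * (u i ^+ 2 * (u j * g j))
      - 4 * t * s ^- 3 * (u i * g i * u j ^+ 2)); last by field.
  over.
  rewrite !sumrB !big_split -!mulr_sumr/=.
over.
rewrite !sumrB !big_split -!mulr_sumr -!mulr_suml/= -/s -/t.
by field.
Qed.

(** * The energies *)

Lemma trace_e (R : realType) (d : nat) (q : 'rV[R]_d -> R)
    (u : 'I_3 -> 'rV[R]_d -> R) (x : 'rV[R]_d) :
  \tr (e_mx q u x) = q x * \sum_i u i x ^+ 2.
Proof. by rewrite mulr_sumr; apply: eq_bigr => i _; rewrite mxE expr2 mulrA. Qed.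

Lemma trace_E (R : realType) (d : nat) (a : 'rV[R]_d -> R)
    (u : 'I_3 -> 'rV[R]_d -> R) (x : 'rV[R]_d) :
  \tr (E_mx a u x) = a x * \sum_i dot (grad (u i) x) (grad (u i) x).
Proof. by rewrite mulr_sumr; apply: eq_bigr => i _; rewrite mxE. Qed.

Lemma trace_eE (R : realType) (d : nat) (a q : 'rV[R]_d -> R)
    (u : 'I_3 -> 'rV[R]_d -> R) (x : 'rV[R]_d) :
  \tr (e_mx q u x *m E_mx a u x) = a x * q x *
    \sum_i \sum_j u i x * u j x * dot (grad (u i) x) (grad (u j) x).
Proof.
rewrite mulr_sumr; apply: eq_bigr => i _.
rewrite mxE mulr_sumr; apply: eq_bigr => j _.
by rewrite !mxE (dotC _ _ (grad (u j) x)); ring.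
Qed.

Lemma energy_defect (R : realType) (d : nat) (a q : 'rV[R]_d -> R)
    (u : 'I_3 -> 'rV[R]_d -> R) (x : 'rV[R]_d)
    (e := e_mx q u x) (E := E_mx a u x) :
  \tr e * \tr E - \tr (e *m E) =
  a x * q x * gram_defect (u ^~ x) (fun i => grad (u i) x).
Proof. by rewrite trace_e trace_E trace_eE /gram_defect; ring. Qed.

(** The velocity of an entry of u u^T / |u|^2, in the form used by
    [proj_energy]. *)
Lemma partial_proj (R : realType) (d N : nat) (u : 'I_N -> 'rV[R]_d -> R)
    (x : 'rV[R]_d) (i j : 'I_N) (m : 'I_d)
    (s := \sum_l u l x ^+ 2) (t := \sum_l u l x * partial m (u l) x) :
  (forall l, differentiable (u l) x) -> s != 0 ->
  partial m (fun y => (\sum_l u l y ^+ 2)^-1 * (u i y * u j y)) x =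
  (u i x * partial m (u j) x + u j x * partial m (u i) x) / s
  - u i x * u j x * (2 * t) / s ^+ 2.
Proof.
move=> du s0; rewrite /partial; set v := delta_mx _ _.
have D l : is_derive x v (u l) ('D_v (u l) x).
  by apply: DeriveDef => //; exact: diff_derivable.
pose S := \sum_l u l ^+ 2.
have SE y : S y = \sum_l u l y ^+ 2 by rewrite /S fct_sumE.
have DS : is_derive x v S (2 * t).
  apply: is_derive_eq.
  by rewrite mulr_sumr; apply: eq_bigr => l _; rewrite /GRing.scale/= expr1 mulrA.
have S0 : S x != 0 by rewrite SE.
have DSV : is_derive x v (fun y => (S y)^-1) (- (S x) ^- 2 *: (2 * t)).
  by apply: DeriveDef; [exact: derivableV|rewrite deriveV// derive_val].
rewrite (_ : (fun y => _) = (fun y => (S y)^-1) * (u i * u j)); last first.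
  by apply/funext => y; rewrite -SE.
rewrite derive_val /GRing.scale/= !SE -/s.
have -> : (u i * u j) x = u i x * u j x by [].
by field.
Qed.

(** The factor q cancels in e / tr e on a neighbourhood of x, which leaves only
    u to differentiate. *)
Lemma grad_norm2_normalized_e (R : realType) (d : nat) (q : 'rV[R]_d -> R)
    (u : 'I_3 -> 'rV[R]_d -> R) (x : 'rV[R]_d) (s := \sum_i u i x ^+ 2) :
  (\forall y \near x, q y != 0) -> (forall i, differentiable (u i) x) ->
  s != 0 ->
  grad_mx_norm2 (fun y => (\tr (e_mx q u y))^-1 *: e_mx q u y) x =
  2 * gram_defect (u ^~ x) (fun i => grad (u i) x) / s ^+ 2.
Proof.
move=> q0 du s0; rewrite gram_defect_coord mulr_sumr mulr_suml /grad_mx_norm2.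
pose D i j m := (u i x * partial m (u j) x + u j x * partial m (u i) x) / s
  - u i x * u j x * (2 * \sum_l u l x * partial m (u l) x) / s ^+ 2.
transitivity (\sum_i \sum_j \sum_m D i j m ^+ 2).
  apply: eq_bigr => i _; apply: eq_bigr => j _.
  rewrite enorm_sqr; apply: eq_bigr => m _; rewrite -expr2 mxE; congr (_ ^+ 2).
  rewrite -[RHS]partial_proj//; apply: near_eq_derive.
  near=> y; have qy0 : q y != 0 by near: y.
  by rewrite !mxE trace_e invfM [_^-1 * _]mulrC -!mulrA mulKf.
under eq_bigr do rewrite exchange_big/=.
rewrite exchange_big; apply: eq_bigr => m _.
rewrite proj_energy//; congr (2 * (_ * _ - _ ^+ 2) / _).
  by apply: eq_bigr => i _; rewrite mxE.
by apply: eq_bigr => i _; rewrite mxE.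
Unshelve. all: by end_near. Qed.

Theorem theorem2p6 (R : realType) (lambda beta1 b : R)
    (lambda_gt0 : 0 < lambda) (beta1_gt0 : 0 < beta1) (b_gt0 : 0 < b) :
  exists2 C : R, 0 < C &
  forall (d : nat) (alpha Lambda beta2 Kmin Kmax p r : R)
    (Omega Omega' : set 'rV[R]_d) (a q : 'rV[R]_d -> R)
    (K : set R) (phi : 'I_3 -> 'rV[R]_d -> R)
    (u : R -> 'I_3 -> 'rV[R]_d -> R),
  d = 2%N \/ d = 3%N ->
  0 < alpha < 1 ->
  0 < Lambda -> 0 < beta2 ->
  0 < Kmin -> Kmin < Kmax ->
  0 < p -> 0 < r ->
  C1a_domain alpha Omega -> C1a_domain alpha Omega' -> Omega' `<=` Omega ->
  holder_on alpha (closure Omega) a ->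
  (forall x, closure Omega x -> lambda <= a x <= Lambda) ->
  measurable_fun (Omega : set (leb_rV R d)) (q : leb_rV R d -> R) ->
  (forall x, Omega x -> beta1 <= q x <= beta2) ->
  proper_measurements alpha Omega Omega' a q Kmin Kmax p r K phi u ->
  (forall k i x, K k -> Omega' x ->
     `|E_mx a (u k) x i i| <= b /\ `|e_mx q (u k) x i i| <= b) ->
  forall (x : 'rV[R]_d) (k : R),
  Omega' x -> K k -> proper_at p r (u k) x ->
  let e := e_mx q (u k) in
  let EE := E_mx a (u k) in
  let Q := (\tr (e x) * \tr (EE x) - \tr (e x *m EE x)) / \tr (e x) ^+ 2 in
  C * p ^+ 2 * r ^+ 4 <= Q /\
  grad_mx_norm2 (fun y => (\tr (e y))^-1 *: e y) x * (a x / q x) = 2 * Q.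
Proof.
(* lambda and beta1 bound a and q below; 27 b^3 collects (q s)^2 <= (3 b)^2 and
   a G <= 3 b, and the further lambda^2 / b^2 turns r^2 into r^4. *)
exists (2 * lambda ^+ 4 * beta1 / (27 * b ^+ 5)).
  by rewrite divr_gt0 ?mulr_gt0 ?exprn_gt0// ltr0n.
move=> d alpha Lambda beta2 Kmin Kmax p r Omega Omega' a q K phi u _ _ _ _ _ _.
move=> p_gt0 r_gt0 _ [oOmega' _ _ _ _] sub _ a_bnd _ q_bnd [_ sol _] energy_bnd.
move=> x k Ox Kk [u1_ge area_ge] e EE Q.
pose s := \sum_i u k i x ^+ 2.
pose P := gram_defect (u k ^~ x) (fun i => grad (u k i) x).
pose G := \sum_i dot (grad (u k i) x) (grad (u k i) x).
have /andP[a_ge _] : lambda <= a x <= Lambda.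
  by apply: a_bnd; apply: subset_closure; exact: sub.
have /andP[q_ge _] := q_bnd _ (sub _ Ox).
have ax_gt0 : 0 < a x by exact: lt_le_trans a_ge.
have qx_gt0 : 0 < q x by exact: lt_le_trans q_ge.
have du i : differentiable (u k i) x.
  by have [[_ + _] _] := sol k i Kk; apply; exact: sub.
have p2_le : p ^+ 2 <= u k idx1 x ^+ 2.
  by rewrite -[leRHS]real_normK ?num_real// lerXn2r ?nnegrE// ltW.
have s_gt0 : 0 < s.
  apply: (lt_le_trans (exprn_gt0 2 p_gt0)); apply: (le_trans p2_le).
  rewrite /s (bigD1 idx1)//= lerDl.
  by apply: sumr_ge0 => i _; exact: sqr_ge0.
have QE : Q = a x / q x * (P / s ^+ 2).
  rewrite /Q /e /EE energy_defect trace_e -/s -/P.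
  by field; rewrite !gt_eqF.
split; last first.
  rewrite grad_norm2_normalized_e//; last by rewrite gt_eqF.
    by rewrite QE -/s -/P; ring.
  near=> y; have /sub/q_bnd/andP[qy_ge _] : Omega' y.
    by near: y; exact: open_nbhs_nbhs.
  by rewrite gt_eqF// (lt_le_trans beta1_gt0).
have grad_bnd i : a x * dot (grad (u k i) x) (grad (u k i) x) <= b.
  have [+ _] := energy_bnd k i x Kk Ox.
  by rewrite mxE; apply: le_trans; exact: ler_norm.
have u_bnd i : q x * u k i x ^+ 2 <= b.
  have [_] := energy_bnd k i x Kk Ox.
  by rewrite mxE -mulrA -expr2; apply: le_trans; exact: ler_norm.
have three_bnd (c : R) (f : 'I_3 -> R) :
    (forall i, c * f i <= b) -> c * \sum_i f i <= 3 * b.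
  move=> fb; rewrite mulr_sumr (le_trans (ler_sum _ (fun i _ => fb i)))//.
  by rewrite sumr_const card_ord mulr_natl.
have qs_bnd : q x * s <= 3 * b by exact: three_bnd.
have G_bnd : a x * G <= 3 * b by exact: three_bnd.
have r2_le : r ^+ 2 <= dot (grad (u k idx2) x) (grad (u k idx2) x) *
    dot (grad (u k idx3) x) (grad (u k idx3) x) -
    dot (grad (u k idx2) x) (grad (u k idx3) x) ^+ 2.
  rewrite -parallelogram_area lerXn2r ?nnegrE ?(ltW r_gt0)//.
  exact: le_trans (ltW r_gt0) area_ge.
have PG : 2 * (p ^+ 2 * r ^+ 2) <= P * G.
  apply: le_trans (gram_defect_area R d (u k ^~ x) (fun i => grad (u k i) x)).
  by rewrite -mulrA ler_pM2l// ler_pM// exprn_ge0// ltW.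
have G_ge0 : 0 <= G by apply: sumr_ge0 => i _; exact: dot_ge0.
have pr_gt0 : 0 < p ^+ 2 * r ^+ 2 by rewrite mulr_gt0// exprn_gt0.
have PG_gt0 : 0 < P * G by apply: lt_le_trans PG; rewrite mulr_gt0.
have G_gt0 : 0 < G.
  rewrite lt_def G_ge0 andbT.
  by apply: contraTneq PG_gt0 => ->; rewrite mulr0 ltxx.
have P_gt0 : 0 < P by rewrite -(pmulr_lgt0 _ G_gt0).
have P_ge : lambda * (2 * (p ^+ 2 * r ^+ 2)) <= 3 * b * P.
  apply: (@le_trans _ _ (a x * G * P)); last by rewrite ler_pM2r.
  rewrite -mulrA [G * P]mulrC; apply: ler_pM => //; first exact: ltW.
  by rewrite ltW// mulr_gt0.
have r_bnd : lambda ^+ 2 * r ^+ 2 <= b ^+ 2.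
  have grad_ge0 i : 0 <= lambda * dot (grad (u k i) x) (grad (u k i) x).
    by rewrite mulr_ge0 ?dot_ge0// ltW.
  have grad_le i : lambda * dot (grad (u k i) x) (grad (u k i) x) <= b.
    by apply: le_trans (grad_bnd i); rewrite ler_wpM2r ?dot_ge0.
  rewrite [leRHS]expr2.
  apply: le_trans (ler_pM (grad_ge0 _) (grad_ge0 _) (grad_le idx2) (grad_le idx3)).
  rewrite [leRHS]mulrACA -[lambda * lambda]expr2 ler_pM2l ?exprn_gt0//.
  rewrite (le_trans r2_le)// gerBl.
  exact: sqr_ge0.
have Q_ge : lambda * beta1 * P <= Q * (3 * b) ^+ 2.
  have -> : Q = a x * q x * P / (q x * s) ^+ 2.
    by rewrite QE; field; rewrite !gt_eqF.
  rewrite [leRHS]mulrAC ler_pdivlMr ?exprn_gt0 ?mulr_gt0//.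
  apply: ler_pM.
  - by rewrite !mulr_ge0// ltW.
  - by rewrite exprn_ge0// mulr_ge0// ltW.
  - by rewrite ler_pM2r// ler_pM// ltW.
  - by rewrite lerXn2r// nnegrE mulr_ge0// ltW.
rewrite (_ : _ * r ^+ 4 = lambda * beta1 * (lambda * (2 * (p ^+ 2 * r ^+ 2)))
    * (lambda ^+ 2 * r ^+ 2) / (27 * b ^+ 5)); last by field; rewrite gt_eqF.
rewrite ler_pdivrMr ?mulr_gt0 ?exprn_gt0//.
apply: (@le_trans _ _ (lambda * beta1 * (3 * b * P) * b ^+ 2)).
  apply: ler_pM => //; rewrite ?ler_pM2l ?mulr_gt0//.
  - by rewrite ltW// !mulr_gt0.
  - by rewrite ltW// mulr_gt0 ?exprn_gt0.
rewrite (_ : _ * b ^+ 2 = lambda * beta1 * P * (3 * b ^+ 3)); last by ring.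
rewrite (_ : Q * _ = Q * (3 * b) ^+ 2 * (3 * b ^+ 3)); last by ring.
by rewrite ler_pM2r// mulr_gt0 ?exprn_gt0.
Unshelve. all: by end_near. Qed.
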